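(* Let $\Theta\subset\mathbb{R}$ be a countable set and let $F_1,\dots,F_D:\mathbb{R}^+\to\mathbb{R}$ be $B^1$-almost periodic functions with $\Lambda(F_j)\subset\Theta$ for $1\le j\le D$. Let $(S_1,\dots,S_D)$ be a random vector distributed according to the limiting distribution of $(F_1,\dots,F_D)$. Then $$\mathbb{P}(S_1>\dots>S_D)\le\liminf_{X\to+\infty}\frac1X\int_0^X\mathbf{1}_{x_1>\dots>x_D}(F_1(y),\dots,F_D(y))\,\mathrm{d}y$$ $$\le\limsup_{X\to+\infty}\frac1X\int_0^X\mathbf{1}_{x_1>\dots>x_D}(F_1(y),\dots,F_D(y))\,\mathrm{d}y\le\mathbb{P}(S_1\ge\dots\ge S_D).$$
   Context: The $B^1$ semi-norm of a locally integrable function $f$ is $\|f\|_{B^1}=\limsup_{X\to+\infty}\frac1X\int_0^X|f(y)|\,\mathrm{d}y$. A (locally integrable) function $F:\mathbb{R}^+\to\mathbb{R}$ is $B^1$-almost periodic if there is a sequence $(P_N)_{N\ge1}$ of trigonometric polynomials $P_N(t)=\sum_{n=1}^{D_N}r_{n,N}e^{i\lambda_{n,N}t}$ ($r_{n,N}\in\mathbb{C}$, $\lambda_{n,N}\in\mathbb{R}$) with $\|F-P_N\|_{B^1}\to0$. The support $\Lambda(F)$ of such an $F$ is the (countable) set of $\lambda\in\mathbb{R}$ such that $\lim_{X\to+\infty}\frac1X\int_0^XF(y)e^{-i\lambda y}\,\mathrm{d}y\ne0$. A function $E:\mathbb{R}^+\to\mathbb{R}^D$ admits the limiting distribution $\mu$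 if $\mu$ is a Borel probability measure on $\mathbb{R}^D$ such that $\frac1X\int_0^Xg(E(y))\,\mathrm{d}y\to\int_{\mathbb{R}^D}g\,\mathrm{d}\mu$ as $X\to+\infty$ for every bounded continuous $g:\mathbb{R}^D\to\mathbb{R}$; vectors of $B^1$-almost periodic functions are known to admit limiting distributions. $\mathbf{1}_{x_1>\dots>x_D}$ is the indicator function of $\{x\in\mathbb{R}^D:x_1>\dots>x_D\}$. *)

(* Defs.v *)
From HB Require Import structures.
From mathcomp Require Import all_boot all_order all_algebra.
From mathcomp Require Import complex.
From mathcomp Require Import all_classical all_reals all_analysis.

Set Implicit Arguments.
Unset Strict Implicit.
Unset Printing Implicit Defensive.

Import Order.TTheory GRing.Theory Num.Theory.
Import numFieldNormedType.Exports.

Local Open Scope classical_set_scope.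
Local Open Scope complex_scope.
Local Open Scope ring_scope.

(* The completed measure makes "measurable" mean Lebesgue measurable rather
   than Borel measurable. *)
Notation leb R := (@completed_lebesgue_measure R).

(* A function on R^+ is a function on R of which only the values on [0, +oo[
   are ever used. *)
Definition locally_integrable_ge0 (R : realType) (f : R -> R) : Prop :=
  forall K : set R, compact K -> K `<=` `[0, +oo[ ->
    (leb R).-integrable K (EFin \o f).

Definition expi (R : realType) (t : R) : R[i] := cos t +i* sin t.

Definition is_trig_poly (R : realType) (P : R -> R[i]) : Prop :=
  exists (D : nat) (r : 'I_D -> R[i]) (lambda : 'I_D -> R),
    forall t, P t = \sum_(n < D) r n * expi (lambda n * t).

Definition running_mean (R : realType) (f : R -> R) (X : R) : \bar R :=
  ((X^-1)%:E * \int[leb R]_(y in `[0%R, X]) (f y)%:E)%E.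

Definition B1norm (R : realType) (f : R -> R[i]) : \bar R :=
  limf_esup (running_mean (fun y => ComplexField.Normc.normc (f y))) +oo.

Definition B1_almost_periodic (R : realType) (F : R -> R) : Prop :=
  locally_integrable_ge0 F /\
  exists2 P : nat -> R -> R[i], (forall N, is_trig_poly (P N)) &
    B1norm (fun t => (F t)%:C - P N t) @[N --> \oo] --> 0%E.

Definition cintegral (R : realType) (A : set R) (f : R -> R[i]) : R[i] :=
  (\int[leb R]_(y in A) complex.Re (f y)) +i*
  (\int[leb R]_(y in A) complex.Im (f y)).

Definition fourier_mean (R : realType) (F : R -> R) (lambda X : R) : R[i] :=
  (X^-1)%:C * cintegral `[0, X] (fun y => (F y)%:C * expi (- (lambda * y))).

Definition ap_support (R : realType) (F : R -> R) : set R :=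
  [set lambda | exists2 l : R[i]^o,
    (fourier_mean F lambda X : R[i]^o) @[X --> +oo] --> l & l != 0].

Definition borel_rV (R : realType) (D : nat) :=
  g_sigma_algebraType (@open 'rV[R]_D).

Definition limiting_distribution (R : realType) (D : nat) (E : R -> 'rV[R]_D)
    (mu : probability (borel_rV R D) R) : Prop :=
  forall g : 'rV[R]_D -> R, continuous g -> (exists M : R, forall x, `|g x| <= M) ->
    (X^-1 * \int[leb R]_(y in `[0, X]) g (E y)) @[X --> +oo] -->
      \int[mu]_x g x.

Definition decreasing_vec (R : realType) (D : nat) : set 'rV[R]_D :=
  [set x | forall i j : 'I_D, j = i.+1 :> nat -> x 0 i > x 0 j].

Definition nonincreasing_vec (R : realType) (D : nat) : set 'rV[R]_D :=
  [set x | forall i j : 'I_D, j = i.+1 :> nat -> x 0 i >= x 0 j].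

Arguments decreasing_vec {R D}.
Arguments nonincreasing_vec {R D}.

(* Main.v *)
Require Import Defs.
From HB Require Import structures.
From mathcomp Require Import all_boot all_order all_algebra.
From mathcomp Require Import complex.
From mathcomp Require Import all_classical all_reals all_analysis.
From mathcomp Require Import measurable_realfun.

Set Implicit Arguments.
Unset Strict Implicit.
Unset Printing Implicit Defensive.

Import Order.TTheory GRing.Theory Num.Theory.
Import numFieldNormedType.Exports.

Local Open Scope classical_set_scope.
Local Open Scope ring_scope.

(** This is the portmanteau argument for Cesaro means in place of a sequence of
    laws.  With [min_gap x] the least difference x_i - x_(i+1) of consecutive
    coordinates (capped at 1), a vector is decreasing iff [0 < min_gap x] and
    nonincreasing iff [0 <= min_gap x].  As [min_gap] is continuous, the first
    set is open and the second closed.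

    The indicator of the open set is the limit, from below, of the continuous
    functions [clamp (n * min_gap x)], where [clamp] truncates to [0, 1]; that of
    the closed set is the limit, from above, of [clamp (1 + n * min_gap x)].  For
    each fixed n the limiting distribution turns the mean of such a function
    along F into its integral against mu, so this integral is at most the lower
    mean of the first indicator ([integral_le_einf_mean]), respectively at least
    the upper mean of the second ([esup_mean_le_integral]).  Letting n tend to
    infinity, dominated convergence ([cvg_integral_indic]) replaces the integrals
    by the probabilities of the two sets.  Finally the indicator of the open set
    is bounded by that of the closed one. *)

(** * Lower and upper limits along a filter *)

Section Limits.
Local Open Scope ereal_scope.
Context (T : choiceType) (X : filteredType T) (R : realType).
Implicit Types (u : X -> \bar R) (G : set (set X)).

Lemma limf_einf_ge u G (l : \bar R) : G [set x | l <= u x] -> l <= limf_einf u G.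
Proof.
move=> Gu; rewrite limf_einfE; apply: le_ereal_sup_tmp.
exists (ereal_inf (u @` [set x | l <= u x])); first by exists [set x | l <= u x].
by apply: le_ereal_inf_tmp => _ [x ux <-].
Qed.

Lemma limf_esup_le u G (l : \bar R) : G [set x | u x <= l] -> limf_esup u G <= l.
Proof.
move=> Gu; rewrite limf_esupE; apply: ge_ereal_inf.
exists (ereal_sup (u @` [set x | u x <= l])); first by exists [set x | u x <= l].
by apply: ge_ereal_sup => _ [x ux <-].
Qed.

Lemma limf_einf_le_esup u G : ProperFilter G -> limf_einf u G <= limf_esup u G.
Proof.
move=> GF; rewrite limf_einfE limf_esupE.
apply: ge_ereal_sup => _ [A GA <-]; apply: le_ereal_inf_tmp => _ [B GB <-].
have [x [Ax Bx]] := filter_ex (filterI GA GB).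
apply: (@le_trans _ _ (u x)).
  by apply: ereal_inf_lbound; exists x.
by apply: ereal_sup_ubound; exists x.
Qed.

End Limits.

(** * Integrals and running means of functions with values in [0, 1] *)

(** The integral of a nonnegative function is the supremum of the integrals of
    the simple functions below it, and this supremum is monotone whether or not
    the functions are measurable. *)
Lemma ge0_le_integral_nomeas d (T : measurableType d) (R : realType)
    (mu : {measure set T -> \bar R}) (D : set T) (f g : T -> \bar R) :
  (forall x, D x -> (0 <= f x)%E) -> (forall x, D x -> (f x <= g x)%E) ->
  (\int[mu]_(x in D) f x <= \int[mu]_(x in D) g x)%E.
Proof.
move=> f0 fg; rewrite integral_mkcond [leRHS]integral_mkcond.
have fg_patch x : (0 <= (f \_ D) x <= (g \_ D) x)%E.
  rewrite !patchE; case: ifPn => [/set_mem Dx|_]; last by rewrite lexx.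
  by rewrite f0//= fg.
rewrite !ge0_integralTE => [||x]; last 2 first.
- by move=> x; have /andP[h1 h2] := fg_patch x; exact: le_trans h2.
- by have /andP[] := fg_patch x.
apply: ereal_sup_le => _ [h hf <-]; exists h => // x.
by have /andP[_] := fg_patch x; exact: le_trans.
Qed.

Lemma running_mean_fin (R : realType) (g : R -> R) (X : R) :
  0 < X -> (forall y, 0 <= g y <= 1) ->
  running_mean g X = (X^-1 * \int[leb R]_(y in `[0, X]) g y)%:E.
Proof.
move=> X0 g01; rewrite /running_mean EFinM fineK//.
rewrite ge0_fin_numE; last first.
  by apply: integral_ge0 => y _; rewrite lee_fin; have /andP[] := g01 y.
apply: (@le_lt_trans _ _ (\int[leb R]_(y in `[0%R, X]) (cst 1 y)%E)%E).
  by apply: ge0_le_integral_nomeas => y _; rewrite lee_fin; have /andP[] := g01 y.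
rewrite integral_cst; last by apply: sub_caratheodory; exact: measurable_itv.
(* The completed measure and the Lebesgue measure are the same outer measure,
   taken on different sigma-algebras. *)
rewrite mul1e -[ltLHS]/(lebesgue_measure `[0, X]) lebesgue_measure_itv/=.
by rewrite lte_fin X0 -EFinB ltry.
Qed.

Lemma le_running_mean (R : realType) (f g : R -> R) (X : R) :
  0 < X -> (forall y, 0 <= f y) -> (forall y, f y <= g y) ->
  (running_mean f X <= running_mean g X)%E.
Proof.
move=> X0 f0 fg; apply: lee_wpmul2l; first by rewrite lee_fin invr_ge0 ltW.
by apply: ge0_le_integral_nomeas => y _; rewrite lee_fin.
Qed.

(** * Truncation to [0, 1] *)

Section Clamp.
Context (R : realType).
Implicit Types t : R.

Definition clamp t : R := Num.max 0 (Num.min 1 t).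

Lemma clamp_ge0 t : 0 <= clamp t.
Proof. by rewrite /clamp le_max lexx. Qed.

Lemma clamp_le1 t : clamp t <= 1.
Proof. by rewrite /clamp ge_max ler01 ge_min lexx. Qed.

Lemma clamp_eq0 t : t <= 0 -> clamp t = 0.
Proof. by move=> t0; rewrite /clamp; apply/max_idPl; rewrite ge_min t0 orbT. Qed.

Lemma clamp_eq1 t : 1 <= t -> clamp t = 1.
Proof. by move=> t1; rewrite /clamp (min_idPl t1); apply/max_idPr. Qed.

Lemma continuous_clamp : continuous clamp.
Proof.
move=> t; apply: (@continuous_max _ _ (cst 0) (fun t => Num.min 1 t)).
  exact: cst_continuous.
by apply: (@continuous_min _ _ (cst 1) id); [exact: cst_continuous|].
Qed.

Lemma near_natmul_ge1 t : 0 < t -> \forall n \near \oo, 1 <= n%:R * t.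
Proof.
move=> t0; near=> n; rewrite -ler_pdivrMr// div1r.
by near: n; exact: nbhs_infty_ger.
Unshelve. all: by end_near. Qed.

(** Steepening the ramp while keeping its foot at 0 gives the indicator of the
    open half-line. *)
Lemma clamp_cvg_gt0 t : clamp (n%:R * t) @[n --> \oo] --> ((0 < t)%R%:R : R).
Proof.
have [t0|t0] := ltrP 0 t; apply: cvg_near_cst.
  by apply: filterS (near_natmul_ge1 t0) => n nt; rewrite clamp_eq1.
by near=> n; rewrite clamp_eq0// mulr_ge0_le0.
Unshelve. all: by end_near. Qed.

(** Steepening the ramp while keeping its top at 0 gives the indicator of the
    closed half-line. *)
Lemma clamp_cvg_ge0 t : clamp (1 + n%:R * t) @[n --> \oo] --> ((0 <= t)%R%:R : R).
Proof.
have [t0|t0] := lerP 0 t; apply: cvg_near_cst.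
  by near=> n; rewrite clamp_eq1// lerDl mulr_ge0.
have := near_natmul_ge1 (t := - t); rewrite oppr_gt0 => /(_ t0).
by apply: filterS => n nt; rewrite clamp_eq0// -lerBrDl sub0r lerNr -mulrN.
Unshelve. all: by end_near. Qed.

End Clamp.

(** * The portmanteau inequalities for running means *)

Lemma continuous_measurable_rV (R : realType) (D : nat) (g : 'rV[R]_D -> R) :
  continuous g -> measurable_fun setT (g : borel_rV R D -> R).
Proof.
move=> cg; apply: (measurability _ (RGenOpens.measurableE R)).
move=> _ [_ [a [b ->]] <-]; rewrite setTI; apply: sub_sigma_algebra.
by apply: open_comp => //; exact: interval_open.
Qed.

Lemma indic_bool (R : pzRingType) (T : Type) (b : pred T) (x : T) :
  \1_[set x | b x] x = (b x)%:R :> R.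
Proof.
rewrite indicE; congr (nat_of_bool _)%:R.
by apply/idP/idP => [/set_mem|bx]//; exact: mem_set.
Qed.

Section ContinuousSuperlevel.
Context (R : realType) (D : nat) (m : 'rV[R]_D -> R) (cm : continuous m).

Lemma measurable_gt0_set :
  measurable ([set x | 0 < m x] : set (borel_rV R D)).
Proof.
apply: sub_sigma_algebra.
by apply: (@open_comp _ _ m [set t | 0 < t]); [move=> x _; exact: cm|exact: open_gt].
Qed.

Lemma measurable_ge0_set :
  measurable ([set x | 0 <= m x] : set (borel_rV R D)).
Proof.
rewrite -[X in measurable X]setCK; apply: measurableC; apply: sub_sigma_algebra.
rewrite openC; apply: (@preimage_closed _ _ m [set t | 0 <= t]).
  by move=> x _; exact: cm.
exact: closed_ge.
Qed.

Lemma continuous_clamp_affine (a b : R) : continuous (fun x => clamp (a + b * m x)).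
Proof.
move=> x; apply: (continuous_comp (f := fun x => a + b * m x)).
  apply: continuousD; first exact: cst_continuous.
  by apply: continuousM; [exact: cst_continuous|exact: cm].
exact: continuous_clamp.
Qed.

End ContinuousSuperlevel.

Section Portmanteau.
Context (R : realType) (D : nat) (E : R -> 'rV[R]_D).
Context (mu : probability (borel_rV R D) R) (Emu : limiting_distribution E mu).
Implicit Types (f : R -> R) (g m : 'rV[R]_D -> R).

Lemma Rintegral_prob g : (forall x, 0 <= g x <= 1) ->
  (\int[mu]_x g x)%:E = (\int[mu]_x (g x)%:E)%E.
Proof.
move=> g01; rewrite fineK// ge0_fin_numE; last first.
  by apply: integral_ge0 => x _; rewrite lee_fin; have /andP[] := g01 x.
apply: (@le_lt_trans _ _ (\int[mu]_x (cst 1 x)%E)%E).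
  by apply: ge0_le_integral_nomeas => x _; rewrite lee_fin; have /andP[] := g01 x.
rewrite integral_cst// mul1e.
by apply: le_lt_trans (probability_le1 mu measurableT) _; exact: ltry.
Qed.

Lemma bounded01 g : (forall x, 0 <= g x <= 1) ->
  exists M : R, forall x, `|g x| <= M.
Proof.
by move=> g01; exists 1 => x; have /andP[g0 g1] := g01 x; rewrite ger0_norm.
Qed.

(** The means of g along E tend to the integral of g and lie below those of f. *)
Lemma integral_le_einf_mean g f : continuous g -> (forall x, 0 <= g x <= 1) ->
  (forall y, g (E y) <= f y) ->
  (\int[mu]_x (g x)%:E <= limf_einf (running_mean f) +oo%R)%E.
Proof.
move=> cg g01 gf; rewrite -Rintegral_prob//.
apply/lee_subgt0Pr => e e0; apply: limf_einf_ge.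
near=> X; have X0 : 0 < X by near: X; exact: nbhs_pinfty_gt.
apply: (@le_trans _ _ (running_mean (g \o E) X)); last first.
  by apply: le_running_mean => // y; have /andP[] := g01 (E y).
rewrite running_mean_fin => [||y]; [|exact: X0|exact: g01].
rewrite lee_fin ltW//; near: X.
by apply: cvgr_gt (Emu cg (bounded01 g01)) _ _; rewrite ltrBlDr ltrDl.
Unshelve. all: by end_near. Qed.

(** The means of g along E tend to the integral of g and lie above those of f. *)
Lemma esup_mean_le_integral g f : continuous g -> (forall x, 0 <= g x <= 1) ->
  (forall y, 0 <= f y) -> (forall y, f y <= g (E y)) ->
  (limf_esup (running_mean f) +oo%R <= \int[mu]_x (g x)%:E)%E.
Proof.
move=> cg g01 f0 fg; rewrite -Rintegral_prob//.
apply/lee_addgt0Pr => e e0; apply: limf_esup_le.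
near=> X; have X0 : 0 < X by near: X; exact: nbhs_pinfty_gt.
apply: (@le_trans _ _ (running_mean (g \o E) X)).
  exact: le_running_mean.
rewrite running_mean_fin => [||y]; [|exact: X0|exact: g01].
rewrite lee_fin ltW//; near: X.
by apply: cvgr_lt (Emu cg (bounded01 g01)) _ _; rewrite ltrDl.
Unshelve. all: by end_near. Qed.

(** Dominated convergence, the dominating function being the constant 1. *)
Lemma cvg_integral_indic (A : set (borel_rV R D)) (g_ : nat -> 'rV[R]_D -> R) :
  measurable A -> (forall n, continuous (g_ n)) ->
  (forall n x, 0 <= g_ n x <= 1) ->
  (forall x, g_ n x @[n --> \oo] --> (\1_A x : R)) ->
  (\int[mu]_x (g_ n x)%:E @[n --> \oo] --> mu A)%E.
Proof.
move=> mA cg g01 gA.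
have -> : mu A = (\int[mu]_x (\1_A x)%:E)%E by rewrite integral_indic// setIT.
apply: (@dominated_cvg _ _ _ mu setT _ (fun n x => (g_ n x)%:E) _ (cst 1%E)) => //.
- by move=> n; apply/measurable_EFinP; exact: continuous_measurable_rV.
- by move=> x _; apply: cvg_EFin; [exact: nearW|exact: gA].
- exact: finite_measure_integrable_cst.
- move=> n x _; have /andP[g0 g1] := g01 n x.
  by rewrite abse_EFin lee_fin ger0_norm.
Qed.

(** Each ramp [clamp (n * m)] lies below the indicator of the open set, and the
    ramps converge to it. *)
Lemma gt0_set_le_einf_mean m : continuous m ->
  (mu [set x | (0 < m x)%R]
    <= limf_einf (running_mean (fun y => \1_[set x | (0 < m x)%R] (E y))) +oo%R)%E.
Proof.
move=> cm; set U := [set x | _].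
pose g_ n x := clamp (0 + n%:R * m x).
have g01 n x : 0 <= g_ n x <= 1 by rewrite clamp_ge0 clamp_le1.
have cg n : continuous (g_ n) by exact: continuous_clamp_affine.
have gU x : g_ n x @[n --> \oo] --> (\1_U x : R).
  rewrite (indic_bool _ (fun x => 0 < m x)) /g_; under eq_fun do rewrite add0r.
  exact: clamp_cvg_gt0.
have cvgU := cvg_integral_indic (measurable_gt0_set cm) cg g01 gU.
rewrite -(cvg_lim _ cvgU)//; apply: lime_le; first by apply/cvg_ex; exists (mu U).
apply: nearW => n; apply: integral_le_einf_mean => // y.
rewrite (indic_bool _ (fun x => 0 < m x)).
have [m0|m0] := ltrP 0 (m (E y)); first exact: clamp_le1.
by rewrite /g_ clamp_eq0// add0r mulr_ge0_le0.
Qed.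

(** Each ramp [clamp (1 + n * m)] lies above the indicator of the closed set, and
    the ramps converge to it. *)
Lemma esup_mean_le_ge0_set m f : continuous m -> (forall y, 0 <= f y) ->
  (forall y, f y <= \1_[set x | 0 <= m x] (E y)) ->
  (limf_esup (running_mean f) +oo%R <= mu [set x | (0 <= m x)%R])%E.
Proof.
move=> cm f0 fC; set C := [set x | _].
pose g_ n x := clamp (1 + n%:R * m x).
have g01 n x : 0 <= g_ n x <= 1 by rewrite clamp_ge0 clamp_le1.
have cg n : continuous (g_ n) by exact: continuous_clamp_affine.
have gC x : g_ n x @[n --> \oo] --> (\1_C x : R).
  by rewrite (indic_bool _ (fun x => 0 <= m x)); exact: clamp_cvg_ge0.
have cvgC := cvg_integral_indic (measurable_ge0_set cm) cg g01 gC.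
rewrite -(cvg_lim _ cvgC)//; apply: lime_ge; first by apply/cvg_ex; exists (mu C).
apply: nearW => n; apply: esup_mean_le_integral => // y.
apply: le_trans (fC y) _; rewrite (indic_bool _ (fun x => 0 <= m x)).
have [m0|m0] := lerP 0 (m (E y)); last exact: clamp_ge0.
by rewrite /g_ clamp_eq1// lerDl mulr_ge0.
Qed.

End Portmanteau.

(** * Monotone vectors through the smallest gap *)

Section Gap.
Context (R : realType) (D : nat).

(** The cap at 1 is the value of the empty minimum when [D <= 1], in which case
    every vector is decreasing; being positive, it does not affect the sign. *)
Definition min_gap (x : 'rV[R]_D) : R :=
  \big[Num.min/1]_(p : 'I_D * 'I_D | p.2 == p.1.+1 :> nat) (x 0 p.1 - x 0 p.2).

Lemma continuous_min_gap : continuous min_gap.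
Proof.
apply: continuous_big => [|p _ x]; first exact: min_continuous.
by apply: continuousB; exact: coord_continuous.
Qed.

Lemma decreasing_vecE : decreasing_vec = [set x | 0 < min_gap x].
Proof.
apply/seteqP; split=> x /=.
  move=> dx; apply/bigmin_gtP; split=> // -[i j] /= /eqP ij.
  by rewrite subr_gt0; exact: dx.
move/bigmin_gtP => [_ dx] i j ij.
by rewrite -subr_gt0; apply: (dx (i, j)); apply/eqP.
Qed.

Lemma nonincreasing_vecE : nonincreasing_vec = [set x | 0 <= min_gap x].
Proof.
apply/seteqP; split=> x /=.
  move=> dx; apply/bigmin_geP; split=> // -[i j] /= /eqP ij.
  by rewrite subr_ge0; exact: dx.
move/bigmin_geP => [_ dx] i j ij.
by rewrite -subr_ge0; apply: (dx (i, j)); apply/eqP.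
Qed.

End Gap.

(** * The density of decreasing values *)

Theorem proposition2p14 (R : realType) (Theta : set R) (D : nat)
    (F : 'I_D -> R -> R) (mu : probability (borel_rV R D) R)
    (d : measure_display) (Omega : measurableType d) (P : probability Omega R)
    (S : {RV P >-> borel_rV R D}) :
  countable Theta ->
  (forall j, B1_almost_periodic (F j)) ->
  (forall j, ap_support (F j) `<=` Theta) ->
  limiting_distribution (fun y => \row_j F j y) mu ->
  (forall A : set (borel_rV R D), measurable A -> distribution P S A = mu A) ->
  let indic (y : R) : R := \1_decreasing_vec (\row_j F j y) in
  [/\ (P [set w | decreasing_vec (S w)] <= limf_einf (running_mean indic) +oo%R)%E,
      (limf_einf (running_mean indic) +oo%R <= limf_esup (running_mean indic) +oo%R)%E &
      (limf_esup (running_mean indic) +oo%R <= P [set w | nonincreasing_vec (S w)])%E].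
Proof.
move=> _ _ _ Fmu Smu indic.
have cgap := @continuous_min_gap R D.
split; last 1 first.
- have -> : P [set w | nonincreasing_vec (S w)] = mu nonincreasing_vec.
    by rewrite -Smu// nonincreasing_vecE; exact: measurable_ge0_set.
  rewrite nonincreasing_vecE.
  apply: (esup_mean_le_ge0_set Fmu cgap) => y; rewrite /indic decreasing_vecE.
    by rewrite indic_bool.
  rewrite (indic_bool _ (fun x => 0 < min_gap x)).
  rewrite (indic_bool _ (fun x => 0 <= min_gap x)) ler_nat.
  by case: ltP => // /ltW ->.
- have -> : P [set w | decreasing_vec (S w)] = mu decreasing_vec.
    by rewrite -Smu// decreasing_vecE; exact: measurable_gt0_set.
  by rewrite /indic decreasing_vecE; exact: gt0_set_le_einf_mean.
- exact: limf_einf_le_esup.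
Qed.
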